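(* Let $\mathcal{H}$ be an infinite-dimensional separable Hilbert space, let $A$ be a bounded linear operator on $\mathcal{H}$ with $1\notin\sigma(A)$, let $\{g_j\}_{j\in\Lambda}$ be a Bessel sequence in $\mathcal{H}$ with Bessel bound $\beta>0$, let $W$ be a closed subspace of $\mathcal{H}$, and let $P_W:\mathcal{H}\to\mathcal{H}$ denote the orthogonal projection onto $W$. Consider the non-uniform discrete dynamical system generated by $A$ with arbitrary initial states $x_0,x_{-2}\in\mathcal{H}$ and source term $w\in W$. If the source term $w\in W$ can be stably recovered from the measurements $D(x_0,x_{-2},w)=[\langle x_\lambda,g_j\rangle]_{\lambda\in[2K],\,j\in\Lambda}$ for some $K\in\mathbb{N}$ (that is, for some finite $[2K]$ with $1\le|[2K]|<\infty$), then $\{P_W(I-A^* )^{-1}g_j\}_{j\in\Lambda}$ is a frame for $W$.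
   Context: Let $N\in\mathbb{N}$, $N\ge1$, and let $r$ be a fixed odd integer coprime with $N$ with $1\le r\le 2N-1$. Put $\Lambda=\{0,\tfrac{r}{N}\}+2\mathbb{Z}\subset\mathbb{R}$, and for $K\in\mathbb{N}$, $K\ge1$, put $[2K]=\{2m,\,2m+\tfrac rN: m\in\mathbb{Z},\,-K\le m\le K-1\}\subset\Lambda$. $\mathbb{Z}^+$ and $\mathbb{Z}^-$ denote the positive and negative integers. The Hilbert space $\mathcal{H}$ is real or complex with scalar field $\mathbb{F}\in\{\mathbb{R},\mathbb{C}\}$; all sequences and matrices have entries in $\mathbb{F}$. $\sigma(A)$ is the spectrum of $A$. Non-uniform discrete dynamical system: given a bounded linear operator $A$ on $\mathcal{H}$, a closed subspace $W$ of $\mathcal{H}$, a source term $w\in W$ and initial states $x_0,x_{-2}\in\mathcal{H}$, the states $x_\lambda\in\mathcal{H}$, $\lambda\in\Lambda$, are determined by $$x_{\lambda+\frac rN}=Ax_\lambda+w\ (\lambda\in2\mathbb{Z}),\quad x_{\lambda+2-\frac rN}=Ax_\lambda+w\ (\lambda\in(2\mathbb{Z}^++\tfrac rN)\cup\{\tfrac rN\}),\quad x_{\lambda-2-\frac rN}=Ax_\lambda+w\ (\lambda\in2\mathbb{Z}^-+\tfrac rN).$$ Bessel sequence with Bessel bound $\beta$: $\sum_{j}|\langle f,g_j\rangle|^2\le\beta\|f\|^2$ for all $f\in\mathcal{H}$. A family $\{f_j\}_{j\in\Lambda}\subset W$ is a frame for $W$ if there are constants $\alpha_0,\beta_0>0$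 with $\alpha_0\|f\|^2\le\sum_{j}|\langle f,f_j\rangle|^2\le\beta_0\|f\|^2$ for all $f\in W$. $\mathcal{B}(\ell^2(\Lambda),\mathbb{F}^{[2K]})$ is the Banach space of matrices $T=[a_{ij}]_{i\in[2K],\,j\in\Lambda}$ whose rows $r_i=(a_{ij})_{j\in\Lambda}$ all belong to $\ell^2(\Lambda)$, with norm $\|T\|=\sum_{i\in[2K]}\|r_i\|_{\ell^2(\Lambda)}$. The source term $w\in W$ can be stably recovered from the measurements indexed by $[2K]$ if there is a bounded linear operator $\mathscr{R}:\mathcal{B}(\ell^2(\Lambda),\mathbb{F}^{[2K]})\to\mathcal{H}$ such that $\mathscr{R}\big([\langle x_\lambda,g_j\rangle]_{\lambda\in[2K],\,j\in\Lambda}\big)=w$ for all $x_0,x_{-2}\in\mathcal{H}$ and all $w\in W$. *)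

(* Defs.v *)
From HB Require Import structures.
From mathcomp Require Import all_boot all_order all_algebra.
From mathcomp Require Import complex.
From mathcomp Require Import all_classical all_reals all_analysis.

Set Implicit Arguments.
Unset Strict Implicit.
Unset Printing Implicit Defensive.

Import Order.TTheory GRing.Theory Num.Theory.
Import numFieldNormedType.Exports.

Local Open Scope classical_set_scope.
Local Open Scope ring_scope.

Variant scalar_kind := RealScalars | ComplexScalars.

Definition scalarField (R : realType) (k : scalar_kind) : numFieldType :=
  match k with
  | RealScalars => R : numFieldType
  | ComplexScalars => R[i] : numFieldType
  end.

Definition scalar_conj (R : realType) (k : scalar_kind) :
    scalarField R k -> scalarField R k :=
  match k with
  | RealScalars => fun x => x
  | ComplexScalars => @conjc R
  end.

Definition scalar_re (R : realType) (k : scalar_kind) : scalarField R k -> R :=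
  match k with
  | RealScalars => fun x => x
  | ComplexScalars => fun z : R[i] => complex.Re z
  end.

Lemma scalar_conj_is_additive (R : realType) (k : scalar_kind) :
  zmod_morphism (@scalar_conj R k).
Proof. by case: k => x y //=; exact: (rmorphB (@conjc R)). Qed.

Lemma scalar_conj_is_multiplicative (R : realType) (k : scalar_kind) :
  monoid_morphism (@scalar_conj R k).
Proof.
case: k; split=> //=; [exact: (rmorph1 (@conjc R)) | exact: (rmorphM (@conjc R))].
Qed.

Lemma scalar_conjK (R : realType) (k : scalar_kind) :
  involutive (@scalar_conj R k).
Proof. by case: k => x //=; exact: conjcK. Qed.

HB.instance Definition _ (R : realType) (k : scalar_kind) :=
  GRing.isZmodMorphism.Build (scalarField R k) (scalarField R k) (@scalar_conj R k)
    (@scalar_conj_is_additive R k).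
HB.instance Definition _ (R : realType) (k : scalar_kind) :=
  GRing.isMonoidMorphism.Build (scalarField R k) (scalarField R k) (@scalar_conj R k)
    (@scalar_conj_is_multiplicative R k).
HB.instance Definition _ (R : realType) (k : scalar_kind) :=
  isInvolutive.Build (scalarField R k) (@scalar_conj R k) (@scalar_conjK R k).

(* The norm of a normed module over F takes its values in F itself, so over the
   complex numbers it is a complex number with zero imaginary part. *)
Definition rnorm (R : realType) (k : scalar_kind)
    (V : normedZmodType (scalarField R k)) (x : V) : R := scalar_re `|x|.

(* The inner product is linear in its first argument and conjugate-linear in
   the second. *)
Record hilbertType (R : realType) (k : scalar_kind) := HilbertType {
  hilbert_sort :> completeNormedModType (scalarField R k);
  inner : {dot hilbert_sort for @scalar_conj R k};
  inner_norm : forall x : hilbert_sort, inner x x = `|x| ^+ 2 }.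

Notation "''[' x , y ]" := (inner _ x y)
  (format "''[' x ,  y ]") : ring_scope.

Section HilbertSpace.
Variables (R : realType) (k : scalar_kind) (H : hilbertType R k).
Local Notation F := (scalarField R k).

Definition infinite_dimensional : Prop :=
  forall (n : nat) (e : 'I_n -> H),
    exists x : H, forall c : 'I_n -> F, x <> \sum_(i < n) c i *: e i.

Definition hilbert_separable : Prop := exists2 D : set H, countable D & dense D.

Definition closed_subspace (W : set H) : Prop :=
  [/\ closed W, W 0 & forall (a : F) (u v : H), W u -> W v -> W (a *: u + v)].

Definition bounded_op (T : H -> H) : Prop :=
  exists C : R, forall x, rnorm (T x) <= C * rnorm x.

Definition spectrum (T : H -> H) : set F :=
  [set l | ~ exists B : {linear H -> H},
     [/\ bounded_op B, cancel (fun x => T x - l *: x) B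
       & cancel B (fun x => T x - l *: x)]].

Definition adjoint (T : H -> H) (y : H) : H :=
  xget 0 [set z | forall x, '[T x, y] = '[x, z]].

(* T^-1 y, whenever T is bijective *)
Definition op_inv (T : H -> H) (y : H) : H := xget 0 [set x | T x = y].

Definition orth_proj (W : set H) (x : H) : H :=
  xget 0 [set p | W p /\ forall u, W u -> '[x - p, u] = 0].

Section Families.
Variable I : choiceType.
Local Open Scope ereal_scope.

Definition bessel (g : I -> H) (beta : R) : Prop :=
  forall f : H,
    \esum_(j in [set: I]) ((rnorm ('[f, g j])) ^+ 2)%:E
      <= (beta * rnorm f ^+ 2)%:E.

Definition frame_for (W : set H) (f : I -> H) : Prop :=
  (forall j, W (f j)) /\
  exists alpha0 beta0 : R, [/\ (0 < alpha0)%R, (0 < beta0)%R &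
    forall h : H, W h ->
      (alpha0 * rnorm h ^+ 2)%:E
        <= \esum_(j in [set: I]) ((rnorm ('[h, f j])) ^+ 2)%:E
        <= (beta0 * rnorm h ^+ 2)%:E].

End Families.
End HilbertSpace.

Section Matrices.
Variables (R : realType) (k : scalar_kind) (I J : choiceType).
Local Notation F := (scalarField R k).

Definition in_l2 (a : J -> F) : Prop :=
  (\esum_(j in [set: J]) ((rnorm (a j)) ^+ 2)%:E < +oo)%E.

Definition l2norm (a : J -> F) : R :=
  Num.sqrt (fine (\esum_(j in [set: J]) ((rnorm (a j)) ^+ 2)%:E)%E).

Definition l2_rows (T : I -> J -> F) : Prop := forall i, in_l2 (T i).

(* meant for a finite index type I *)
Definition l2_rows_norm (T : I -> J -> F) : R :=
  \sum_(i \in [set: I]) l2norm (T i).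

End Matrices.

Section NonUniform.
Variables (R : realType) (N r : nat).

Definition offset : R := r%:R / N%:R.

Definition Lambda : set R :=
  [set x | exists m : int, x = 2 * m%:~R \/ x = 2 * m%:~R + offset].

Definition bracket (K : nat) : set Lambda :=
  [set l | exists2 m : int, - K%:Z <= m <= K%:Z - 1 &
     val l = 2 * m%:~R \/ val l = 2 * m%:~R + offset].

Variables (k : scalar_kind) (H : hilbertType R k).
Local Notation F := (scalarField R k).

Definition trajectory (A : H -> H) (w x0 xm2 : H) (x : Lambda -> H) : Prop :=
  [/\ forall l, val l = 0 -> x l = x0,
      forall l, val l = - 2 -> x l = xm2,
      forall l m : Lambda, (exists n : int, val l = 2 * n%:~R) ->
        val m = val l + offset -> x m = A (x l) + w,
      forall l m : Lambda,
        ((exists2 n : int, 0 < n & val l = 2 * n%:~R + offset) \/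
           val l = offset) ->
        val m = val l + 2 - offset -> x m = A (x l) + w
    & forall l m : Lambda,
        (exists2 n : int, n < 0 & val l = 2 * n%:~R + offset) ->
        val m = val l - 2 - offset -> x m = A (x l) + w].

Definition measurements (g : Lambda -> H) (K : nat) (x : Lambda -> H) :
    bracket K -> Lambda -> F :=
  fun l j => '[x (val l), g j].

(* The bounded linear recovery operator has domain the subspace l2_rows;
   its values outside that subspace play no role. *)
Definition stably_recoverable (A : H -> H) (g : Lambda -> H) (W : set H)
    (K : nat) : Prop :=
  exists Rec : (bracket K -> Lambda -> F) -> H,
    [/\ forall (a : F) (S T : bracket K -> Lambda -> F),
          l2_rows S -> l2_rows T ->
          Rec (fun i j => a * S i j + T i j) = a *: Rec S + Rec T,
        exists C : R, forall T : bracket K -> Lambda -> F,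
          l2_rows T -> rnorm (Rec T) <= C * l2_rows_norm T
      & forall (x0 xm2 w : H) (x : Lambda -> H), W w ->
          trajectory A w x0 xm2 x -> Rec (measurements g x) = w].

End NonUniform.

Arguments Lambda R N r : clear implicits.

(* Main.v *)
(* Put u = (I - A)^-1 w. Starting from x_0 = x_-2 = u, the system is stationary:
   x_l = u for all l, so every row of the measurement matrix is the sequence
   (<u, g_j>)_j = (<w, P_W (I - A^* )^-1 g_j>)_j. Boundedness of the recovery
   operator bounds |w| by a multiple of the l2 norm of this sequence, which is
   the lower frame bound; the upper one is the Bessel bound at u. The adjoint
   and the projection are choice-defined, so their characterizations require
   the projection theorem and the Riesz representation theorem. *)
Require Import Defs.
From HB Require Import structures.
From mathcomp Require Import all_boot all_order all_algebra.
From mathcomp Require Import complex.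
From mathcomp Require Import all_classical all_reals all_analysis.
From mathcomp Require Import ring lra.

Set Implicit Arguments.
Unset Strict Implicit.
Unset Printing Implicit Defensive.

Import Order.TTheory GRing.Theory Num.Theory.
Import numFieldNormedType.Exports.

Local Open Scope classical_set_scope.
Local Open Scope ring_scope.

(** * Passage between real numbers and nonnegative scalars *)

Section Scalars.
Variables (R : realType) (k : scalar_kind).
Local Notation F := (scalarField R k).

(** Norms take values in F. This order-preserving ring morphism carries identities and inequalities
    between them to R, where infima and estimates are handled. *)
Definition real_scalar : R -> F :=
  match k as k0 return R -> scalarField R k0 with
  | RealScalars => fun x => x
  | ComplexScalars => fun x => x%:C%C
  end.

Lemma real_scalar_is_additive : zmod_morphism real_scalar.
Proof. by rewrite /real_scalar; case: k => x y //=; rewrite rmorphB. Qed.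

Lemma real_scalar_is_multiplicative : monoid_morphism real_scalar.
Proof.
rewrite /real_scalar.
by case: k; split=> // x y; exact: (rmorphM (real_complex R)).
Qed.

HB.instance Definition _ :=
  GRing.isZmodMorphism.Build R F real_scalar real_scalar_is_additive.
HB.instance Definition _ :=
  GRing.isMonoidMorphism.Build R F real_scalar real_scalar_is_multiplicative.

Lemma ler_real_scalar : {mono real_scalar : x y / x <= y}.
Proof. by rewrite /real_scalar; case: k => x y //=; rewrite lecR. Qed.

Lemma ltr_real_scalar : {mono real_scalar : x y / x < y}.
Proof. by rewrite /real_scalar; case: k => x y //=; rewrite ltcR. Qed.

Lemma real_scalar_inj : injective real_scalar.
Proof. exact: fmorph_inj. Qed.

(** In the order of the complex numbers, being nonnegative forces the imaginary part to vanish. *)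
Lemma ge0_real_scalarE (a : F) : 0 <= a -> a = real_scalar (scalar_re a).
Proof.
rewrite /real_scalar; move: a; case: k => //= -[a b] /=.
by rewrite lecE /= => /andP[/eqP-> _].
Qed.

Lemma mulr_conj (a : F) : a * scalar_conj a = `|a| ^+ 2.
Proof.
move: a; case: k => /= a; last by rewrite normCK.
by rewrite real_normK ?num_real// expr2.
Qed.

Lemma ge0_scalar_conj (a : F) : 0 <= a -> scalar_conj a = a.
Proof.
move: a; case: k => //= -[a b]; rewrite lecE /= => /andP[/eqP-> _].
by rewrite oppr0.
Qed.

Lemma rnormE (V : normedZmodType F) (x : V) : `|x| = real_scalar (rnorm x).
Proof. exact: ge0_real_scalarE. Qed.

Lemma rnorm_ge0 (V : normedZmodType F) (x : V) : 0 <= rnorm x.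
Proof. by rewrite -ler_real_scalar -rnormE rmorph0. Qed.

Lemma rnormN (V : normedZmodType F) (x : V) : rnorm (- x) = rnorm x.
Proof. by rewrite /rnorm normrN. Qed.

End Scalars.

(** * Inner product identities and the Cauchy-Schwarz inequality *)

Section HilbertTheory.
Variables (R : realType) (k : scalar_kind) (H : hilbertType R k).
Local Notation F := (scalarField R k).
Implicit Types (x y z u v : H) (W : set H) (a : F).

Lemma innerC x y : '[x, y] = scalar_conj '[y, x].
Proof. by have := hermC (inner H) x y; rewrite expr0 mul1r. Qed.

Lemma innerBl x y z : '[x - y, z] = '[x, z] - '[y, z].
Proof. exact: linearBl. Qed.

Lemma innerDl x y z : '[x + y, z] = '[x, z] + '[y, z].
Proof. exact: linearDl. Qed.

Lemma innerZl a x z : '[a *: x, z] = a * '[x, z].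
Proof. exact: linearZl_LR. Qed.

Lemma innerNl x z : '[- x, z] = - '[x, z].
Proof. exact: linearNl. Qed.

Lemma innerBr x y z : '[z, x - y] = '[z, x] - '[z, y].
Proof. exact: linearBr. Qed.

Lemma innerDr x y z : '[z, x + y] = '[z, x] + '[z, y].
Proof. exact: linearDr. Qed.

Lemma innerNr x z : '[z, - x] = - '[z, x].
Proof. exact: linearNr. Qed.

Lemma innerZr a x z : '[z, a *: x] = scalar_conj a * '[z, x].
Proof. exact: linearZr_LR. Qed.

Lemma sqr_normBZ a x y : `|x - a *: y| ^+ 2 =
  `|x| ^+ 2 - scalar_conj a * '[x, y] - a * '[y, x]
  + a * scalar_conj a * `|y| ^+ 2.
Proof.
rewrite -[LHS]inner_norm innerBl !innerBr !innerZl !innerZr !inner_norm.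
by rewrite opprB addrA !mulrA addrAC.
Qed.

(** For nonzero [y], expand the squared norm of [|y|^2 x - <x, y> y], which is nonnegative, and
    cancel the positive factor [|y|^2]. *)
Lemma cauchy_schwarz x y : `|'[x, y]| <= `|x| * `|y|.
Proof.
have [->|y0] := eqVneq y 0; first by rewrite raddf0 !normr0 mulr0.
have ny : 0 < `|y| ^+ 2 by rewrite exprn_gt0 ?normr_gt0.
rewrite -(ler_pXn2r (n := 2))// ?nnegrE ?mulr_ge0// exprMn.
have := exprn_ge0 2 (normr_ge0 (`|y| ^+ 2 *: x - '[x, y] *: y)).
rewrite -[X in 0 <= X -> _]inner_norm innerBl !innerBr !innerZl !innerZr.
rewrite !inner_norm (ge0_scalar_conj (ltW ny)) (innerC y x) -mulr_conj.
set c := scalar_conj _; set b := inner _ x y; set p := `|y|; set q := `|x|.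
have -> : p ^+ 2 * (p ^+ 2 * q ^+ 2) - p ^+ 2 * (c * b)
   - (b * (p ^+ 2 * c) - b * (c * p ^+ 2)) = p ^+ 2 * (q ^+ 2 * p ^+ 2 - b * c).
  by ring.
by rewrite pmulr_rge0// subr_ge0.
Qed.

Lemma parallelogram x y :
  rnorm (x + y) ^+ 2 + rnorm (x - y) ^+ 2 = 2 * (rnorm x ^+ 2 + rnorm y ^+ 2).
Proof.
apply: (@real_scalar_inj R k).
rewrite rmorphM !rmorphD !rmorphXn /= -!rnormE -!inner_norm.
rewrite innerDl innerBl !innerBr !innerDr rmorph1; ring.
Qed.

Lemma rnormZ a x : rnorm (a *: x) = rnorm a * rnorm x.
Proof.
by apply: (@real_scalar_inj R k); rewrite rmorphM /= -!rnormE normrZ.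
Qed.

Lemma rnorm_triangle x y : rnorm (x + y) <= rnorm x + rnorm y.
Proof. by rewrite -(ler_real_scalar k) rmorphD /= -!rnormE ler_normD. Qed.

(** * Orthogonal projection, Riesz representation and adjoints *)

Lemma closed_subspaceD W u v :
  closed_subspace W -> W u -> W v -> W (u + v).
Proof. by case=> _ _ WP Wu Wv; rewrite -[u]scale1r; apply: WP. Qed.

Lemma closed_subspaceZ W a u : closed_subspace W -> W u -> W (a *: u).
Proof. by case=> _ W0 WP Wu; rewrite -[_ *: _]addr0; apply: WP. Qed.

(* A minimizing sequence is Cauchy by the parallelogram law. *)
Lemma nearest_point W x : closed_subspace W ->
  exists2 p, W p & forall u, W u -> `|x - p| <= `|x - u|.
Proof.
move=> sW; have [Wc W0 _] := sW.
pose D := [set rnorm (x - u) ^+ 2 | u in W].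
have Dinf : has_inf D.
  split; first by exists (rnorm (x - 0) ^+ 2), 0.
  by exists 0 => _ [u _ <-]; exact: exprn_ge0 (rnorm_ge0 _).
pose d := inf D.
have dle u : W u -> d <= rnorm (x - u) ^+ 2.
  by move=> Wu; apply: ge_inf; [exact: Dinf.2 | exists u].
have /choice [w wP] : forall n : nat, exists u,
    W u /\ rnorm (x - u) ^+ 2 < d + n.+1%:R^-1.
  move=> n; have [|_ [u Wu <-] ltu] := @inf_adherent _ D n.+1%:R^-1 _ Dinf.
    by rewrite invr_gt0.
  by exists u.
have wdist m n : rnorm (w m - w n) ^+ 2 <= 2 * (m.+1%:R^-1 + n.+1%:R^-1).
  have [Wm ltm] := wP m; have [Wn ltn] := wP n.
  have := parallelogram (x - w n) (x - w m).
  have -> : x - w n - (x - w m) = w m - w n by rewrite opprB addrC addrA subrK.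
  have -> : x - w n + (x - w m) = (2 : F) *: (x - (2^-1 : F) *: (w m + w n)).
    rewrite scalerBr scalerA mulfV ?pnatr_eq0// scale1r (scaler_nat 2 x) mulr2n.
    by rewrite opprD addrACA [- w m - _]addrC.
  (* The midpoint lies in [W], so its squared distance to [x] is at least [d]. This lower bound
     turns the parallelogram law into an upper bound on the gap. *)
  have mid : d <= rnorm (x - (2^-1 : F) *: (w m + w n)) ^+ 2.
    by apply: dle; apply: closed_subspaceZ => //; exact: closed_subspaceD.
  have two : rnorm (2 : F) = 2.
    by apply: (@real_scalar_inj R k); rewrite -rnormE normr_nat rmorph_nat.
  rewrite rnormZ two exprMn; move: mid ltm ltn.
  set A := rnorm _ ^+ 2; set B := rnorm _ ^+ 2; set C := rnorm _ ^+ 2.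
  by set E := rnorm _ ^+ 2; set i := _^-1; set j := _^-1; lra.
have /cauchy_cvgP wcvg : cauchy (w @ \oo).
  apply/cauchy_ballP => e e0.
  have e0' : 0 < scalar_re e.
    by rewrite -(ltr_real_scalar k) -ge0_real_scalarE ?rmorph0 ?ltW.
  rewrite near_map2; near=> m n; rewrite -ball_normE /=.
  rewrite (ge0_real_scalarE (ltW e0)) rnormE ltr_real_scalar.
  rewrite -(ltr_pXn2r (n := 2)) ?nnegrE ?rnorm_ge0 ?ltW//.
  apply: le_lt_trans (wdist _ _) _.
  have small (t : R) : t < scalar_re e ^+ 2 / 4 -> 2 * t < scalar_re e ^+ 2 / 2.
    by set s := _ ^+ 2 => ?; lra.
  rewrite mulrDr [ltRHS]splitr ltrD//; apply: small.
    near: m; apply: near_infty_natSinv_lt (PosNum _).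
    by rewrite divr_gt0 ?exprn_gt0.
  near: n; apply: near_infty_natSinv_lt (PosNum _).
  by rewrite divr_gt0 ?exprn_gt0.
have Wp : W (lim (w @ \oo)).
  by apply: (closed_cvg _ Wc) wcvg; near=> n; exact: (wP n).1.
exists (lim (w @ \oo)) => // u Wu; rewrite !rnormE ler_real_scalar.
rewrite leNgt; apply/negP; set p := lim _.
set b := rnorm (x - u); set a := rnorm (x - p) => ba.
have b0 : 0 <= b by exact: rnorm_ge0.
(* If [b < a], then for large [n] the triangle inequality puts [w n] farther than [(a + b) / 2] from
   [x], while near-minimality puts its squared distance below [b ^+ 2] plus this gap. *)
have gap : 0 < ((a + b) / 2) ^+ 2 - b ^+ 2.
  by rewrite subr_gt0 ltr_pXn2r ?nnegrE//; lra.
have halfgap : 0 < real_scalar k ((a - b) / 2).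
  by rewrite -(rmorph0 (real_scalar k)) ltr_real_scalar divr_gt0 ?subr_gt0.
near \oo => n.
have [Wn ltn] := wP n.
have close : rnorm (w n - p) < (a - b) / 2.
  rewrite -(ltr_real_scalar k) -rnormE -normrN opprB; near: n.
  by move/cvgrPdist_lt : wcvg; apply.
have small : n.+1%:R^-1 < ((a + b) / 2) ^+ 2 - b ^+ 2.
  by near: n; exact: near_infty_natSinv_lt (PosNum gap).
have := rnorm_triangle (x - w n) (w n - p); rewrite addrA subrK -/a.
have := dle _ Wu; rewrite -/b; have := rnorm_ge0 (x - w n).
move: ltn close small; set c := rnorm _; set e := rnorm _; set i := _^-1.
by move=> *; nra.
Unshelve. all: by end_near. Qed.

(** The nearest point is a witness for the choice: moving it inside [W] along [u] cannot decrease
    the distance to [x], which forces orthogonality. *)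
Lemma orth_projP W x : closed_subspace W ->
  W (orth_proj W x) /\ forall u, W u -> '[x - orth_proj W x, u] = 0.
Proof.
move=> sW; apply: (@xgetPex H 0
  [set p | W p /\ forall u, W u -> '[x - p, u] = 0]).
have [p Wp pmin] := nearest_point x sW; exists p; split=> // u Wu.
(* The step [t * a] changes the squared distance by [- |a|^2 t (2 - t |u|^2)]. This [t] makes the
   factor of [|a|^2] strictly negative, even for [u = 0], so [a] must vanish. *)
set q := x - p; set a := '[q, u]; pose t : F := (1 + `|u| ^+ 2)^-1.
have su : 0 <= `|u| ^+ 2 by rewrite exprn_ge0.
have t0 : 0 < t by rewrite invr_gt0 ltr_wpDr.
have := pmin (p + (t * a) *: u) _; rewrite opprD addrA -/q => qmin.
have {}qmin : `|q| ^+ 2 <= `|q - (t * a) *: u| ^+ 2.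
  rewrite ler_pXn2r ?nnegrE//; apply: qmin.
  by apply: closed_subspaceD => //; exact: closed_subspaceZ.
move: qmin; rewrite sqr_normBZ rmorphM /= (ge0_scalar_conj (ltW t0)).
rewrite (innerC u q) -/a; set c := scalar_conj a.
have -> : `|q| ^+ 2 - t * c * a - t * a * c + t * a * (t * c) * `|u| ^+ 2 =
    `|q| ^+ 2 - (a * c) * (t * (2 - t * `|u| ^+ 2)) by ring.
rewrite mulr_conj lerBrDr gerDl pmulr_lle0; last first.
  rewrite mulr_gt0// subr_gt0 mulrC ltr_pdivrMr ?ltr_wpDr//.
  by rewrite mulrDr mulr1 ltr_pwDl// ler_peMl// ler1n.
move=> a0; apply/eqP; rewrite -normr_eq0 -sqrf_eq0.
by apply/eqP/le_anti; rewrite a0 exprn_ge0.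
Qed.

(** Unless [phi] vanishes, projecting some [e] outside its kernel onto that kernel leaves a nonzero
    normal vector [n], and a multiple of [n] represents [phi]. *)
Lemma riesz_representation (phi : H -> F) (D : F) : linear_for *%R phi ->
  (forall x, `|phi x| <= D * `|x|) -> exists z, forall x, phi x = '[x, z].
Proof.
move=> philin phiD.
have phi0 : phi 0 = 0.
  by apply/eqP; rewrite -normr_le0 (le_trans (phiD 0))// normr0 mulr0.
have phiB u v : phi (u - v) = phi u - phi v.
  by rewrite addrC -scaleN1r philin mulN1r addrC.
pose W : set H := [set x | phi x = 0].
have [allW|] := pselect (forall x, W x).
  by exists 0 => x; rewrite allW raddf0.
move=> /existsNP [e We].
have D0 : 0 <= D.
  have e0 : 0 < `|e| by rewrite normr_gt0; apply: contra_notN We => /eqP->.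
  by rewrite -(pmulr_lge0 _ e0) (le_trans _ (phiD e)).
have sW : closed_subspace W.
  split=> // [x clx|a u v]; last first.
    by rewrite /W /= philin => -> ->; rewrite mulr0 addr0.
  (* The kernel is closed: a kernel point within [|phi x| / (D + 1)] of [x] would give
     [|phi x| < |phi x|]. The added 1 covers [D = 0]. *)
  apply: contrapT => /eqP phix.
  have r0 : 0 < `|phi x| / (D + 1).
    by rewrite divr_gt0 ?normr_gt0// ltr_wpDl.
  have [y [Wy]] := clx _ (nbhsx_ballx x _ r0).
  rewrite -ball_normE /= => xy.
  have := phiD (x - y); rewrite phiB Wy subr0 => le1.
  suff : `|phi x| < `|phi x| by rewrite ltxx.
  apply: le_lt_trans le1 _; rewrite ltr_pdivlMr ?ltr_wpDl// in xy.
  apply: le_lt_trans xy.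
  by rewrite mulrC ler_wpM2l// lerDl.
have [Wp porth] := orth_projP e sW.
set n := e - orth_proj W e in porth.
have phin : phi n = phi e by rewrite phiB Wp subr0.
have phin0 : phi n != 0 by rewrite phin; apply/eqP.
have nn0 : `|n| ^+ 2 != 0.
  rewrite sqrf_eq0 normr_eq0; apply: contra_neq phin0 => ->; exact: phi0.
(* The kernel vector [x - (phi x / phi n) n] is orthogonal to [n]. Solving for [phi x] gives this
   multiple, conjugated because the second argument is conjugate-linear. *)
exists (scalar_conj (phi n / `|n| ^+ 2) *: n) => x.
have : '[x - (phi x / phi n) *: n, n] = 0.
  rewrite innerC porth ?rmorph0//.
  by rewrite /W /= phiB -[_ *: n]addr0 philin phi0 addr0 divfK// subrr.
rewrite innerBl innerZl inner_norm => /eqP; rewrite subr_eq0 => /eqP xn.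
rewrite innerZr scalar_conjK; move: (`|n| ^+ 2) nn0 xn => b b0 ->.
by rewrite [RHS]mulrC -!mulrA (mulrCA b) mulfV// mulr1 mulVf// mulr1.
Qed.

Lemma bounded_opP (T : H -> H) : bounded_op T ->
  exists D : F, forall x, `|T x| <= D * `|x|.
Proof.
case=> C TC; exists (real_scalar k C) => x.
by rewrite !rnormE -rmorphM ler_real_scalar.
Qed.

(** The functional [x |-> <T x, y>] is bounded by Cauchy-Schwarz, so its Riesz vector is a witness
    for the choice. *)
Lemma adjointP (T : {linear H -> H}) : bounded_op T ->
  forall x y, '[T x, y] = '[x, adjoint T y].
Proof.
move=> /bounded_opP[D TD] x y; move: x.
apply: (@xgetPex H 0 [set z | forall x, '[T x, y] = '[x, z]]).
apply: (@riesz_representation (fun x => '[T x, y]) (D * `|y|)) => [a u v|x].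
  by rewrite linearP innerDl innerZl.
apply: le_trans (cauchy_schwarz _ _) _.
by rewrite mulrAC ler_wpM2r.
Qed.

Lemma inner_ext y z : (forall x, '[x, y] = '[x, z]) -> y = z.
Proof.
move=> yz; apply/eqP; rewrite -subr_eq0 -normr_eq0 -sqrf_eq0 -inner_norm.
by rewrite innerBr yz subrr.
Qed.

(** Taking adjoints in [B (A - I) = I] shows that [- adjoint B y] is a preimage of [y], so the
    chosen value is a genuine preimage. *)
Lemma op_inv_adjointP (A B : {linear H -> H}) : bounded_op A -> bounded_op B ->
  cancel (fun x => A x - x) B -> forall y,
  let z := op_inv (fun x => x - adjoint A x) y in z - adjoint A z = y.
Proof.
move=> Ab Bb AB y; apply: (@xgetPex H 0 [set x | x - adjoint A x = y]).
exists (- adjoint B y); apply: inner_ext => x.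
rewrite innerBr -(adjointP Ab) !innerNr -!(adjointP Bb) opprK addrC.
by rewrite -innerBl -linearB AB.
Qed.

Lemma inner_orth_proj W u x :
  closed_subspace W -> W u -> '[u, orth_proj W x] = '[u, x].
Proof.
move=> sW Wu; have [_ porth] := orth_projP x sW.
by apply/eqP; rewrite eq_sym -subr_eq0 -innerBr innerC porth// rmorph0.
Qed.

(** This moves the inverse of [I - adjoint A] across the inner product, where it becomes [- B], the
    inverse of [I - A]. Write [y] as [z - adjoint A z], transfer [A] to the left, and use
    [(A - I) B = I]. *)
Lemma inner_op_inv_adjoint (A B : {linear H -> H}) :
  bounded_op A -> bounded_op B ->
  cancel (fun x => A x - x) B -> cancel B (fun x => A x - x) -> forall u y,
  '[u, op_inv (fun x => x - adjoint A x) y] = - '[B u, y].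
Proof.
move=> Ab Bb AB BA u y; rewrite -{2}(op_inv_adjointP Ab Bb AB y) /=.
by rewrite innerBr -(adjointP Ab) opprB -innerBl BA.
Qed.

End HilbertTheory.

(* Off a finite support the sum is [0] by convention, which is why the index
   type need not be finite here. *)
Lemma fsum_const (R : idomainType) (I : choiceType) (c : R) :
  \sum_(i \in [set: I]) c = c * \sum_(i \in [set: I]) (1 : R).
Proof. by rewrite mulr_fsumr; apply: eq_fsbigr => i _; rewrite mulr1. Qed.

(** [l2norm] passes through [fine], which sends an infinite sum to 0; finiteness makes it
    faithful. *)
Lemma esum_sqr_l2norm (R : realType) (k : scalar_kind) (J : choiceType)
    (a : J -> scalarField R k) : in_l2 a ->
  (\esum_(j in [set: J]) ((rnorm (a j)) ^+ 2)%:E)%E = (l2norm a ^+ 2)%:E.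
Proof.
rewrite /in_l2 /l2norm; set s := (\esum_(j in _) _)%E => s_fin.
have s0 : (0 <= s)%E.
  by apply: esum_ge0 => j _; rewrite lee_fin exprn_ge0// rnorm_ge0.
by rewrite sqr_sqrtr ?fine_ge0// fineK// ge0_fin_numE.
Qed.

(** * The stationary trajectory and the two frame bounds *)

Lemma constant_trajectory (R : realType) (N r : nat) (k : scalar_kind)
    (H : hilbertType R k) (A : H -> H) (w u : H) :
  u = A u + w -> @trajectory R N r k H A w u u (fun=> u).
Proof. by split. Qed.

Theorem theorem3p16 (R : realType) (k : scalar_kind) (H : hilbertType R k)
    (N r : nat) (N_ge1 : (1 <= N)%N) (r_odd : odd r) (r_coprime : coprime r N)
    (r_bounds : (1 <= r <= 2 * N - 1)%N)
    (H_infdim : infinite_dimensional H) (H_sep : hilbert_separable H)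
    (A : {linear H -> H}) (A_bounded : bounded_op A)
    (A_spec : ~ spectrum A 1)
    (g : Lambda R N r -> H) (beta : R) (beta_gt0 : 0 < beta)
    (g_bessel : bessel g beta)
    (W : set H) (W_closed : closed_subspace W)
    (recoverable : exists2 K : nat, (1 <= K)%N & stably_recoverable A g W K) :
  frame_for W
    (fun j => orth_proj W (op_inv (fun x => x - adjoint A x) (g j))).
Proof.
have [K _ [Rec [_ [C RecC] RecW]]] := recoverable.
(* [B] inverts [A - I], not [I - A], so the stationary state for [w] is [- B w]. *)
have [B [B_bounded AB BA]] := contrapT A_spec.
have {}AB : cancel (fun x => A x - x) B by move=> x; rewrite -{2}[x]scale1r AB.
have {}BA : cancel B (fun x => A x - x).
  by move=> x; have := BA x; rewrite scale1r.
split=> [j|]; first exact: (orth_projP _ W_closed).1.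
have [D BD] := B_bounded.
pose a w j := '[- B w, g j].
have a_esum w : W w -> (\esum_(j in [set: Lambda R N r])
    (rnorm '[w, orth_proj W (op_inv (fun x => x - adjoint A x) (g j))] ^+ 2)%:E
    = \esum_(j in [set: Lambda R N r]) (rnorm (a w j) ^+ 2)%:E)%E.
  move=> Ww; apply: eq_esum => j _; rewrite inner_orth_proj//.
  by rewrite (inner_op_inv_adjoint A_bounded B_bounded AB BA) /a innerNl.
have a_bessel w : (\esum_(j in [set: Lambda R N r]) (rnorm (a w j) ^+ 2)%:E
    <= (beta * rnorm (- B w) ^+ 2)%:E)%E by exact: g_bessel.
have a_l2 w : in_l2 (a w) by apply: le_lt_trans (a_bessel w) _; rewrite ltry.
(* The number of rows: all rows of the stationary matrix equal [a w], so its norm is [n] times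
   [l2norm (a w)]. *)
pose n := \sum_(i \in [set: @bracket R N r K]) (1 : R).
have w_le w : W w -> rnorm w <= C * n * l2norm (a w).
  move=> Ww; rewrite -mulrA [n * _]mulrC -fsum_const.
  rewrite -{1}(RecW (- B w) (- B w) w (fun=> - B w) Ww); last first.
    by apply: constant_trajectory; rewrite linearN -[X in _ + X]BA addKr.
  by apply: RecC => i; exact: a_l2.
(* These come from squaring [w_le] and the bound on [B]; adding 1 keeps both constants positive when
   [C * n] or [D] is 0. *)
exists (((C * n) ^+ 2 + 1)^-1), (beta * D ^+ 2 + 1).
have Cn : 0 < (C * n) ^+ 2 + 1 by rewrite ltr_wpDl// sqr_ge0.
split; first by rewrite invr_gt0.
  by rewrite ltr_wpDl// mulr_ge0 ?sqr_ge0// ltW.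
move=> w Ww; rewrite a_esum//; apply/andP; split.
  rewrite esum_sqr_l2norm// lee_fin mulrC ler_pdivrMr//.
  apply: (@le_trans _ _ ((C * n) ^+ 2 * l2norm (a w) ^+ 2)).
    rewrite -exprMn ler_pXn2r ?nnegrE ?rnorm_ge0 ?w_le//.
    (* The sign of [C] is unknown, but the product is nonnegative because it bounds a norm. *)
    exact: le_trans (rnorm_ge0 _) (w_le _ Ww).
  by rewrite mulrC ler_wpM2l ?sqr_ge0// lerDl.
apply: le_trans (a_bessel w) _; rewrite lee_fin rnormN.
apply: (@le_trans _ _ (beta * D ^+ 2 * rnorm w ^+ 2)).
  rewrite -mulrA ler_wpM2l ?(ltW beta_gt0)// -exprMn.
  rewrite ler_pXn2r ?nnegrE ?rnorm_ge0//.
  exact: le_trans (rnorm_ge0 _) (BD w).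
by rewrite ler_wpM2r ?sqr_ge0// lerDl.
Qed.
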